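(* For every integer $k\ge 1$, define the formal power series $$C_k(q)=(-1)^k\Biggl(1-\frac{1}{(q;q)_\infty}\sum_{r=1-k}^{k}(-1)^r q^{r(3r-1)/2}\Biggr)\prod_{m\ge 1}\bigl(1-q^{2N_m}\bigr).$$ Then $C_k(q)$ has nonnegative coefficients for all $k\ge 1$. Furthermore, writing $C_k(q)=\sum_{n\ge 0}c_k(n)q^n$, we have $c_k(n)>0$ if and only if $n\ge g_k$, where $g_k=\frac{k(3k+1)}{2}$.
   Context: All series are formal power series in $q$ with integer coefficients. $(a;q)_\infty:=\prod_{i\ge 0}(1-aq^i)$, so $(q;q)_\infty=\prod_{m\ge 1}(1-q^m)$. For a positive integer $m$, $\nu_2(m)=\max\{a\ge 0: 2^a\mid m\}$ is the $2$-adic valuation, and $N_m=m\bigl(1+\tfrac{\nu_2(m)}{2}\bigr)$, so that $2N_m=m(\nu_2(m)+2)$ is a positive integer. For $k\ge 1$, $g_k:=\frac{k(3k+1)}{2}$. *)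

(* Defs.v *)
From HB Require Import structures.
From mathcomp Require Import all_boot all_order all_algebra.
From mathcomp Require Import boolp classical_sets.
From mathcomp Require Import zify.

Set Implicit Arguments.
Unset Strict Implicit.
Unset Printing Implicit Defensive.

Import Order.TTheory GRing.Theory Num.Theory.

Local Open Scope ring_scope.

(* Formal power series in one variable. A series coerces to its sequence of
   coefficients, so [f n] is the coefficient of the n-th power of the
   variable. *)
Record fps (R : Type) := FPS { fps_coef :> nat -> R }.

Lemma fpsP (R : Type) (f g : fps R) : (forall n, f n = g n) -> f = g.
Proof.
by case: f g => [f] [g] /= fg; congr FPS; apply: funext => n; apply: fg.
Qed.

HB.instance Definition _ (R : Type) := gen_eqMixin (fps R).
HB.instance Definition _ (R : Type) := gen_choiceMixin (fps R).

Section FpsZmod.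
Variable R : zmodType.
Implicit Types f g h : fps R.

Definition fps_zero : fps R := FPS (fun=> 0).
Definition fps_opp f : fps R := FPS (fun n => - f n).
Definition fps_add f g : fps R := FPS (fun n => f n + g n).

Fact fps_addA : associative fps_add.
Proof. by move=> f g h; apply: fpsP => n /=; rewrite addrA. Qed.
Fact fps_addC : commutative fps_add.
Proof. by move=> f g; apply: fpsP => n /=; rewrite addrC. Qed.
Fact fps_add0 : left_id fps_zero fps_add.
Proof. by move=> f; apply: fpsP => n /=; rewrite add0r. Qed.
Fact fps_addN : left_inverse fps_zero fps_opp fps_add.
Proof. by move=> f; apply: fpsP => n /=; rewrite addNr. Qed.

HB.instance Definition _ :=
  GRing.isZmodule.Build (fps R) fps_addA fps_addC fps_add0 fps_addN.

Lemma fps0E n : (0 : fps R) n = 0. Proof. by []. Qed.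
Lemma fpsNE f n : (- f) n = - f n. Proof. by []. Qed.
Lemma fpsDE f g n : (f + g) n = f n + g n. Proof. by []. Qed.
Lemma fpsBE f g n : (f - g) n = f n - g n. Proof. by []. Qed.

Lemma fps_sumE (I : Type) (r : seq I) (P : pred I) (F : I -> fps R) n :
  (\sum_(i <- r | P i) F i) n = \sum_(i <- r | P i) F i n.
Proof. by elim/big_rec2: _ => // i x y _ <-. Qed.

End FpsZmod.

Section FpsRing.
Variable R : comNzRingType.
Implicit Types f g h : fps R.

Definition fps_one : fps R := FPS (fun n => (n == 0)%:R).
Definition fps_mul f g : fps R :=
  FPS (fun n => \sum_(i < n.+1) f i * g (n - i)%N).

Definition fps_trunc m f : {poly R} := \poly_(i < m) f i.

Lemma fps_mul_trunc m f g n : (n < m)%N ->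
  fps_mul f g n = (fps_trunc m f * fps_trunc m g)`_n.
Proof.
move=> nm; rewrite coefM /=; apply: eq_bigr => i _.
rewrite !coef_poly (leq_trans (ltn_ord i) nm).
by rewrite (leq_ltn_trans (leq_subr _ _) nm).
Qed.

Fact fps_mulC : commutative fps_mul.
Proof.
by move=> f g; apply: fpsP => n; rewrite !(@fps_mul_trunc n.+1) // mulrC.
Qed.

Fact fps_mulA : associative fps_mul.
Proof.
move=> f g h; apply: fpsP => n.
transitivity ((fps_trunc n.+1 f * fps_trunc n.+1 g * fps_trunc n.+1 h)`_n).
  rewrite -mulrA coefM; apply: eq_bigr => i _.
  rewrite coef_poly ltn_ord (@fps_mul_trunc n.+1) //.
  by rewrite ltnS leq_subr.
rewrite coefM; apply: eq_bigr => i _; rewrite (@fps_mul_trunc n.+1) //.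
by rewrite [X in _ * X]coef_poly ltnS leq_subr.
Qed.

Fact fps_mul1 : left_id fps_one fps_mul.
Proof.
move=> f; apply: fpsP => n /=.
by rewrite big_ord_recl big1 ?addr0 ?mul1r ?subn0 // => i _; rewrite mul0r.
Qed.

Fact fps_mulDl : left_distributive fps_mul (@fps_add R).
Proof.
move=> f g h; apply: fpsP => n /=.
by rewrite -big_split; apply: eq_bigr => i _; rewrite mulrDl.
Qed.

Fact fps_one_neq0 : fps_one != 0.
Proof.
apply/eqP => /(congr1 (fun f : fps R => f 0%N)) /eqP.
by rewrite /= oner_eq0.
Qed.

HB.instance Definition _ := GRing.Zmodule_isComNzRing.Build (fps R)
  fps_mulA fps_mulC fps_mul1 fps_mulDl fps_one_neq0.

Lemma fps1E n : (1 : fps R) n = (n == 0)%:R. Proof. by []. Qed.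
Lemma fpsME f g n : (f * g) n = \sum_(i < n.+1) f i * g (n - i)%N.
Proof. by []. Qed.

Lemma fpsM0 f g : (f * g) 0%N = f 0%N * g 0%N.
Proof. by rewrite fpsME big_ord1. Qed.

Definition fpsC (a : R) : fps R := FPS (fun n => if n == 0%N then a else 0).

Lemma fpsCM a f n : (fpsC a * f) n = a * f n.
Proof.
by rewrite fpsME big_ord_recl big1 ?addr0 ?subn0 // => i _; rewrite mul0r.
Qed.

Definition fpsX : fps R := FPS (fun n => (n == 1)%:R).

Lemma fpsXM f n : (fpsX * f) n = if n is n'.+1 then f n' else 0.
Proof.
rewrite fpsME; case: n => [|n]; first by rewrite big_ord1 mul0r.
rewrite big_ord_recl mul0r add0r big_ord_recl big1 ?addr0 => [|i _].
  by rewrite mul1r /= subSS subn0.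
by rewrite mul0r.
Qed.

Lemma fpsXnE m n : (fpsX ^+ m) n = (n == m)%:R.
Proof.
by elim: m n => [|m IHm] [|n] //; rewrite exprS fpsXM // IHm.
Qed.

Lemma fps_exp_small h i n : h 0%N = 0 -> (n < i)%N -> (h ^+ i) n = 0.
Proof.
move=> h0; elim: i n => // i IHi n; rewrite ltnS exprS => ni.
rewrite fpsME big_ord_recl h0 mul0r add0r big1 // => j _.
have ltjn : (j < n)%N by [].
by rewrite IHi ?mulr0 // lift0 (leq_trans _ ni) // -subn_gt0 subKn.
Qed.

(* Congruence of the coefficients up to a given rank is compatible with the
   product. *)
Lemma fpsM_eq_upto f f' g g' m :
    (forall n, (n <= m)%N -> f n = f' n) ->
    (forall n, (n <= m)%N -> g n = g' n) ->
  forall n, (n <= m)%N -> (f * g) n = (f' * g') n.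
Proof.
move=> ff' gg' n nm; rewrite !fpsME; apply: eq_bigr => i _.
rewrite ff' ?gg' //; first by rewrite (leq_trans (leq_subr _ _)).
by rewrite (leq_trans _ nm) // -ltnS.
Qed.

End FpsRing.

Arguments fps_mul : simpl never.

Section FpsUnit.
Variable R : comUnitRingType.
Implicit Types f g h : fps R.

Definition fps_unit : pred (fps R) := fun f => f 0%N \is a GRing.unit.

(* With [a] the constant coefficient of f and h := 1 - f / a, this is
   a^-1 * (1 + h + h ^ 2 + ...), where only the powers of h of exponent at most
   n contribute to the n-th coefficient. *)
Definition fps_geom f : fps R :=
  let h := 1 - fpsC (f 0%N)^-1 * f in
  FPS (fun n => (f 0%N)^-1 * (\sum_(i < n.+1) h ^+ i) n).

Definition fps_inv f : fps R := if fps_unit f then fps_geom f else f.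

Fact fps_mulVx : {in fps_unit, left_inverse 1 fps_inv *%R}.
Proof.
move=> f; rewrite unfold_in => Uf; rewrite /fps_inv /fps_unit Uf.
set a := f 0%N; set h := 1 - fpsC a^-1 * f.
have h0 : h 0%N = 0 by rewrite /h fpsBE fpsCM mulVr // subrr.
pose S m := \sum_(i < m.+1) h ^+ i.
have geomE m n : (n <= m)%N -> fps_geom f n = (fpsC a^-1 * S m) n.
  move=> nm; rewrite fpsCM /=; congr (_ * _); rewrite /S !fps_sumE.
  rewrite (big_ord_widen m.+1 (fun i => (h ^+ i) n)) ?ltnS //.
  rewrite big_mkcond; apply: eq_bigr => i _; case: ifPn => //.
  by rewrite -leqNgt => ni; rewrite fps_exp_small.
apply: fpsP => n.
rewrite (@fpsM_eq_upto _ _ (fpsC a^-1 * S n) _ f n) //; last by move=> m /geomE.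
have -> : fpsC a^-1 * S n * f = S n * (1 - h).
  by rewrite /h subKr mulrA (mulrC (S n)).
have -> : S n * (1 - h) = 1 - h ^+ n.+1.
  by rewrite mulrC -[in RHS](expr1n _ n.+1) subrXX; congr (_ * _);
     apply: eq_bigr => i _; rewrite expr1n mul1r.
by rewrite fpsBE [X in _ - X]fps_exp_small // subr0.
Qed.

Fact fps_unitPl f g : g * f = 1 -> fps_unit f.
Proof.
move=> /(congr1 (fun f : fps R => f 0%N)); rewrite fpsM0 => gf.
by apply/unitrPr; exists (g 0%N); rewrite mulrC.
Qed.

Fact fps_inv_out : {in [predC fps_unit], fps_inv =1 id}.
Proof.
by move=> f nUf; rewrite /fps_inv ifN //; move: nUf; rewrite !unfold_in.
Qed.

HB.instance Definition _ := GRing.ComNzRing_hasMulInverse.Build (fps R)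
  fps_mulVx fps_unitPl fps_inv_out.

Lemma fps_unitE f : (f \is a GRing.unit) = (f 0%N \is a GRing.unit).
Proof. by []. Qed.

End FpsUnit.

Section FpsLimit.
Variable R : comNzRingType.
Implicit Types (u F : nat -> fps R) (f : fps R).

(* Convergence for the topology of coefficientwise stabilization. *)
Definition fps_cvg u f :=
  forall n, exists N, forall M, (N <= M)%N -> u M n = f n.

(* Coefficients that do not stabilize are given the value 0. *)
Definition fps_lim u : fps R :=
  FPS (fun n => xget 0
    [set c | exists N, forall M, (N <= M)%N -> u M n = c]%classic).

Lemma fps_cvg_lim u f : fps_cvg u f -> fps_lim u = f.
Proof.
move=> uf; apply: fpsP => n /=; case: xgetP => [c _ [N Nc]|/(_ (f n))].
  have [N' N'f] := uf n.
  by rewrite -(Nc (maxn N N')) ?leq_maxl // N'f ?leq_maxr.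
by case; have [N Nf] := uf n; exists N.
Qed.

(* The infinite product of the F i for s <= i. *)
Definition fps_infprod (s : nat) F : fps R :=
  fps_lim (fun N => \prod_(s <= i < N) F i).

Section ProdCvg.
Variables (s : nat) (F : nat -> fps R).
Hypothesis F1 :
  forall i n, (s <= i)%N -> (n < i)%N -> F i n = (n == 0)%:R.

Lemma fps_prod_stable n N M : (n < N)%N -> (N <= M)%N ->
  (\prod_(s <= i < M) F i) n = (\prod_(s <= i < N) F i) n.
Proof.
move=> nN; elim: M => [|M IHM]; first by rewrite leqn0 => /eqP ->.
rewrite leq_eqVlt => /predU1P[<- //|]; rewrite ltnS => NM.
rewrite -IHM //; have [sM|Ms] := leqP s M; last by rewrite !big_geq // ltnW.
rewrite big_nat_recr //.
rewrite (@fpsM_eq_upto _ _ (\prod_(s <= i < M) F i) _ 1 n) ?mulr1 // => j jn.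
by rewrite F1 // (leq_trans _ NM) // (leq_ltn_trans jn).
Qed.

Lemma fps_infprod_cvg :
  fps_cvg (fun N => \prod_(s <= i < N) F i) (fps_infprod s F).
Proof.
suff [f uf] : exists f, fps_cvg (fun N => \prod_(s <= i < N) F i) f.
  by rewrite /fps_infprod (fps_cvg_lim uf).
exists (FPS (fun n => (\prod_(s <= i < n.+1) F i) n)) => n.
by exists n.+1 => M nM /=; rewrite (@fps_prod_stable n n.+1).
Qed.

Lemma fps_infprodE n M : (n < M)%N ->
  fps_infprod s F n = (\prod_(s <= i < M) F i) n.
Proof.
move=> nM; have [N /(_ (maxn N M) (leq_maxl _ _)) <-] := fps_infprod_cvg n.
by rewrite (@fps_prod_stable n M) // leq_maxr.
Qed.

End ProdCvg.

End FpsLimit.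

Local Notation q := (fpsX int).

(* The q-Pochhammer symbol $(a; q)_\infty$. *)
Definition qpoch (a : fps int) : fps int :=
  fps_infprod 0 (fun i => 1 - a * q ^+ i).

Lemma qpoch_cvg a :
  fps_cvg (fun N => \prod_(0 <= i < N) (1 - a * q ^+ i)) (qpoch a).
Proof.
apply: fps_infprod_cvg => i m _ mi; rewrite fpsBE fpsME big1 ?subr0 // => j _.
by rewrite fpsXnE ltn_eqF ?mulr0 // (leq_ltn_trans (leq_subr _ _)).
Qed.

Lemma qpoch_q_unit : qpoch q \is a GRing.unit.
Proof.
rewrite fps_unitE (@fps_infprodE _ 0 _ _ 0 1) // ?big_nat1.
  by rewrite expr0 mulr1 fpsBE subr0 unitr1.
move=> i m _ mi; rewrite -exprS fpsBE fpsXnE ltn_eqF ?subr0 //.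
exact: ltnW.
Qed.

Definition N_ (m : nat) : rat := m%:R * (1 + (logn 2 m)%:R / 2%:R).

(* 2 N_m as a natural number, see [twoNE]. *)
Definition twoN (m : nat) : nat := (m * (logn 2 m + 2))%N.

Lemma twoNE m : (twoN m)%:R = 2%:R * N_ m.
Proof.
rewrite /twoN /N_ natrM natrD mulrCA; congr (_ * _).
by rewrite mulrDr mulr1 mulrCA divff ?mulr1 1?addrC.
Qed.

Lemma twoN_cvg :
  fps_cvg (fun N => \prod_(1 <= m < N) (1 - q ^+ twoN m))
          (fps_infprod 1 (fun m => 1 - q ^+ twoN m)).
Proof.
apply: fps_infprod_cvg => i m _ mi; rewrite fpsBE fpsXnE ltn_eqF ?subr0 //.
by rewrite (leq_trans mi) // leq_pmulr // addn2.
Qed.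

(* r (3 r - 1) / 2 is a nonnegative integer for every r in Z, see
   [pentagonalE]. *)
Definition pentagonal (r : int) : nat := `|((r * (3 * r - 1))%R %/ 2)%Z|%N.

Lemma pentagonalE r : 2 * (pentagonal r)%:Z = r * (3 * r - 1).
Proof.
have even_r : (2 %| (r * (3 * r - 1))%R)%Z.
  rewrite dvdzE abszM /= dvdn2 oddM.
  have -> : odd `|(3 * r - 1)%R|%N = ~~ odd `|r|%N; last by case: (odd _).
  lia.
have pos : 0 <= r * (3 * r - 1) by nia.
rewrite /pentagonal gez0_abs ?divz_ge0 // mulrC.
exact: divzK.
Qed.

(* The series $\sum_{r=1-k}^{k} (-1)^r q^{r(3r-1)/2}$, with r = 1 - k + j. *)
Definition pentagonal_sum (k : nat) : fps int :=
  \sum_(j < 2 * k) let r : int := 1 - k%:Z + j%:Z in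
    (-1) ^ r * q ^+ pentagonal r.

Definition Ck (k : nat) : fps int :=
  (-1) ^+ k * (1 - (qpoch q)^-1 * pentagonal_sum k)
    * fps_infprod 1 (fun m => 1 - q ^+ twoN m).

Definition gk (k : nat) : nat := ((k * (3 * k + 1)) %/ 2)%N.

(* Main.v *)
Require Import Defs.
From mathcomp Require Import all_boot all_order all_algebra.
From mathcomp Require Import zify ring.

(* Let T_k := (-1)^k ((q;q)_oo - sum_{r=1-k}^k (-1)^r q^{r(3r-1)/2}), so that
   C_k = T_k F with F := prod_m (1 - q^{2N_m}) / (1 - q^m). By a finite form of
   the pentagonal number theorem T_k = O(q^{g_k}), and
   T_k = q^{g_k} (1 - q^{2k+1}) - T_{k+1}. Put
     E_k := T_k - q^{g_k} (1 - q^{k-1}).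
   Two steps of the recursion give E_k = q^{g_k} D_k + E_{k+2} where, with
   a = k+2, b = 2k+3 and c = 3k+5 = a+b,
     D_k = q^{k-1} (1 - q^b) ((1 - q^a) (1 - q^c) + q^{4k+6} (1 - q)),
   so everything reduces to the nonnegativity of (1 - q)(1 - q^b) F and the
   positivity of (1 - q^a)(1 - q^b)(1 - q^c) F.
   For those, F = prod_m h_m with h_m = 1 / (1 - q^m) when m is coprime to 6,
   1 + q^m when m is an odd multiple of 3, 1 when m = 2 mod 4, and
   h_m = (1 - q^{2N_m}) / (1 - q^m) when 4 | m: the numerators 1 - q^{3m} for
   m = 2 mod 4 have been moved to the factors 1 - q^{2x} with x = 3m/2. The
   integers a, b, c are pairwise coprime and exactly one of them, v, is even.
   The factor 1 - q^v is a multiple of 1 - q; a factor 1 - q^m with m coprime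
   to 6 cancels against h_m; and for x an odd multiple of 3 greater than 3,
     (1 - q^x) h_x = 1 - q^{2x} = (1 - q^{x-2}) + q^{x-2} (1 - q^{x+2})
   where x - 2 and x + 2 are coprime to 6. *)

Set Implicit Arguments.
Unset Strict Implicit.
Unset Printing Implicit Defensive.

Import Order.TTheory GRing.Theory Num.Theory.

Local Open Scope ring_scope.

Local Notation q := (fpsX int).

(** * Pentagonal exponents and the order of vanishing of T_k *)

Lemma fpsXnM m (f : fps int) n :
  (q ^+ m * f) n = if (m <= n)%N then f (n - m)%N else 0.
Proof.
elim: m n => [|m IHm] n; first by rewrite expr0 mul1r subn0.
by rewrite exprS -mulrA fpsXM; case: n => // n; rewrite IHm ltnS subSS.
Qed.

Lemma gk_double k : (2 * gk k = k * (3 * k + 1))%N.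
Proof. by rewrite /gk mulnC divnK // dvdn2 oddM oddD oddM; case: odd. Qed.

Lemma gk_bin k : gk k = (k * k + 'C(k.+1, 2))%N.
Proof.
have : (2 * 'C(k.+1, 2) = k.+1 * k)%N by rewrite -mul_bin_diag bin1.
move: (gk_double k); nia.
Qed.

Lemma gkS k : gk k.+1 = (gk k + (3 * k + 2))%N.
Proof.
move: (gk_double k) (gk_double k.+1); nia. Qed.

Lemma leq_gk k : (k <= gk k)%N.
Proof. by rewrite gk_bin; case: k => // k; nia. Qed.

(** The new indices are r = -k and r = k+1, with exponents g_k and g_k + 2k + 1. *)
Lemma pentagonal_sumS k :
  pentagonal_sum k.+1 =
  pentagonal_sum k + (-1) ^+ k * q ^+ gk k * (1 - q ^+ (2 * k + 1)).
Proof.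
have peE r m : (2 * m)%:Z = r * (3 * r - 1) -> pentagonal r = m.
  by move=> rm; have := pentagonalE r; lia.
have g2 := gk_double k.
pose G c (j : nat) : fps int := (-1) ^ (c + j%:Z) * q ^+ pentagonal (c + j%:Z).
have GE c i r : c + i%:Z = r -> G c i = (-1) ^ r * q ^+ pentagonal r.
  by rewrite /G => ->.
have SE j : pentagonal_sum j = \sum_(0 <= i < 2 * j) G (1 - j%:Z) i.
  by rewrite big_mkord.
rewrite !SE mulnS big_nat_recl // big_nat_recr //= addrCA; congr (_ + _).
  by apply: eq_bigr => i _; rewrite /G; congr ((-1) ^ _ * q ^+ pentagonal _); lia.
rewrite (@GE _ _ (- k%:Z)); last by lia.
rewrite (@GE _ _ k.+1%:Z); last by lia.
rewrite (@peE (- k%:Z) (gk k)); last by nia.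
rewrite (@peE k.+1%:Z (gk k + (2 * k + 1))%N); last by nia.
rewrite -exprnN -exprVn invrN1 -exprnP exprS exprD; ring.
Qed.

(* Shanks' finite form of the pentagonal number theorem: only the term s = 0 is
   not O(q^k). *)
Definition shanks_term k s : fps int :=
  (-1) ^+ s * \prod_(s <= i < k) (1 - q ^+ i.+1) * q ^+ (s * k + 'C(s.+1, 2)).

(** Telescoping in s. At j = k the product is empty and the right side is the single monomial
    [(-1)^(k+1) q^(g_k + 2k + 1)], which [shanks] uses in its induction on k. *)
Lemma shanks_step k j : (j <= k)%N ->
  \sum_(s < j.+1) (shanks_term k.+1 s - shanks_term k s) =
  - ((-1) ^+ j * \prod_(j <= i < k) (1 - q ^+ i.+1)
      * q ^+ (j.+1 * k.+1 + 'C(j.+1, 2))).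
Proof.
elim: j => [|j IHj] jk.
  rewrite big_ord1 /shanks_term big_nat_recr //= !mul0n !mul1n bin_small // !addn0.
  rewrite !expr0; ring.
rewrite big_ord_recr /= IHj; last exact: ltnW.
rewrite /shanks_term big_nat_recr //= (big_ltn jk).
have -> : 'C(j.+2, 2) = ('C(j.+1, 2) + j.+1)%N by rewrite binS bin1.
set P := \prod_(j.+1 <= _ < k) _.
rewrite !mulSn !mulnS !exprD ?exprS; ring.
Qed.

Lemma shanks k :
  \sum_(s < k.+1) shanks_term k s =
  pentagonal_sum k + (-1) ^+ k * q ^+ gk k.
Proof.
elim: k => [|k IHk].
  by rewrite big_ord1 /shanks_term /pentagonal_sum big_geq // big_ord0 add0r !mulr1.
rewrite big_ord_recr /=.
transitivity (\sum_(s < k.+1) (shanks_term k.+1 s - shanks_term k s)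
   + \sum_(s < k.+1) shanks_term k s + shanks_term k.+1 k.+1).
  by congr (_ + _); rewrite -big_split; apply: eq_bigr => s _ /=; rewrite subrK.
rewrite shanks_step // IHk pentagonal_sumS /shanks_term !big_geq // gkS.
have -> : (k.+1 * k.+1 + 'C(k.+1, 2) = gk k + (2 * k + 1))%N.
  by rewrite gk_bin; lia.
have -> : (k.+1 * k.+1 + 'C(k.+2, 2) = gk k + (3 * k + 2))%N.
  by rewrite gk_bin binS bin1; lia.
rewrite exprS !exprD; ring.
Qed.

Lemma qpoch_upto n N : (n < N)%N ->
  qpoch q n = (\prod_(0 <= i < N) (1 - q ^+ i.+1)) n.
Proof.
move=> nN; rewrite /qpoch (@fps_infprodE _ 0 _ _ n N) //.
  by congr (fps_coef _ n); apply: eq_bigr => i _; rewrite exprS.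
move=> i m _ mi; rewrite -exprS fpsBE fpsXnE ltn_eqF ?subr0 //.
exact: ltnW.
Qed.

Definition pentagonal_tail k : fps int := (-1) ^+ k * (qpoch q - pentagonal_sum k).

Lemma pentagonal_tailS k :
  pentagonal_tail k = q ^+ gk k * (1 - q ^+ (2 * k + 1)) - pentagonal_tail k.+1.
Proof.
rewrite /pentagonal_tail pentagonal_sumS exprS.
have : (-1) ^+ k * (-1) ^+ k = 1 :> fps int by rewrite -exprMn mulrNN mulr1 expr1n.
set e := (-1) ^+ k => ee.
have qe : q ^+ gk k = e * e * q ^+ gk k by rewrite ee mul1r.
rewrite {1}qe; ring.
Qed.

(** For k > n, Shanks' identity leaves only its term s = 0, which agrees with (q;q)_oo at degree n.
    Smaller k follow by downward induction along [pentagonal_tailS], since g_k increases. *)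
Lemma pentagonal_tail_vanish k n : (n < gk k)%N -> pentagonal_tail k n = 0.
Proof.
have far j : (n < j)%N -> pentagonal_tail j n = 0.
  move=> nj; rewrite /pentagonal_tail mulrC -signr_odd.
  suff z : (qpoch q - pentagonal_sum j) n = 0.
    by case: odd; rewrite ?mulr1 ?mulrN1 ?fpsNE z ?oppr0.
  have -> : pentagonal_sum j = \sum_(s < j.+1) shanks_term j s - (-1) ^+ j * q ^+ gk j.
    by rewrite shanks addrK.
  rewrite big_ord_recl !fpsBE fpsDE (qpoch_upto nj) {1}/shanks_term.
  rewrite mul0n expr0 mul1r mulr1.
  rewrite [_ * q ^+ gk j]mulrC fpsXnM leqNgt (leq_trans nj (leq_gk j)) subr0.
  suff -> : (\sum_(i < j) shanks_term j (lift ord0 i)) n = 0 by rewrite addr0 subrr.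
  rewrite fps_sumE big1 // => i _.
  by rewrite /shanks_term mulrC fpsXnM ifN // -ltnNge lift0; nia.
elim: {k}(n.+1 - k)%N {-2}k (leqnn (n.+1 - k)) => [|d IHd] k dk gkn.
  by apply: far; lia.
rewrite pentagonal_tailS fpsBE IHd ?subr0 ?fpsXnM 1?leqNgt ?gkn //; first lia.
by rewrite gkS; lia.
Qed.

(** * The factors h_m of F *)

Definition geo m v : fps int := \sum_(i < v) (q ^+ m) ^+ i.

Lemma geoE m v : (1 - q ^+ m) * geo m v = 1 - q ^+ (m * v).
Proof. by rewrite exprM -opprB mulNr -subrX1 opprB. Qed.

(** This is h_m; for 4 | m the quotient (1 - q^{2N_m}) / (1 - q^m) is written as a polynomial, so
    that nonnegativity is visible. *)
Definition fac m : fps int :=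
  if odd m then if (3 %| m)%N then 1 + q ^+ m else (1 - q ^+ m)^-1
  else if (4 %| m)%N then geo m (logn 2 m + 2) else 1.

Lemma oneBXn_unit m : (0 < m)%N -> 1 - q ^+ m \is a GRing.unit.
Proof. by case: m => // m _; rewrite fps_unitE fpsBE fpsXnE subr0 unitr1. Qed.

Lemma fac_unit m : odd m -> ~~ (3 %| m)%N -> (1 - q ^+ m) * fac m = 1.
Proof. by move=> om m3; rewrite /fac om ifN // divrr // oneBXn_unit //; lia. Qed.

Lemma fac_odd3 m : odd m -> (3 %| m)%N -> (1 - q ^+ m) * fac m = 1 - q ^+ (2 * m).
Proof. by move=> om m3; rewrite /fac om m3 mulnC exprM; ring. Qed.

Lemma fac_mod2 m : (m %% 4 = 2)%N -> (1 - q ^+ m) * fac m = 1 - q ^+ m.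
Proof.
move=> m2; rewrite /fac.
have -> : odd m = false by lia.
have -> : (4 %| m)%N = false by lia.
by rewrite mulr1.
Qed.

Lemma fac_dvd4 m : (4 %| m)%N -> (1 - q ^+ m) * fac m = 1 - q ^+ twoN m.
Proof.
move=> m4; rewrite /fac m4.
have -> : odd m = false by lia.
exact: geoE.
Qed.

Lemma twoN_odd m : odd m -> twoN m = (2 * m)%N.
Proof. by move=> om; rewrite /twoN lognE dvdn2 om andbF mulnC. Qed.

Lemma twoN_mod2 m : (m %% 4 = 2)%N -> twoN m = (3 * m)%N.
Proof.
move=> m2; have -> : m = (2 * m./2)%N by lia.
have om : odd m./2 by lia.
rewrite /twoN lognM //; last exact: odd_gt0.
by rewrite (logn_prime 2) //= [logn 2 m./2]lognE dvdn2 om !andbF /=; lia.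
Qed.

(* The products of the E have different lengths on both sides, but the same
   limit when E i = 1 - q^i. *)
Lemma prod_mod12 (R : comNzRingType) (G H E : nat -> R) K :
    (forall m, odd m -> ~~ (3 %| m)%N -> G m = 1) ->
    (forall m, odd m -> (3 %| m)%N -> G m = E (2 * m)%N) ->
    (forall m, (m %% 4 = 2)%N -> G m = E m) ->
    (forall m, (4 %| m)%N -> G m = H m) ->
    (forall m, odd m -> H m = E (2 * m)%N) ->
    (forall m, (m %% 4 = 2)%N -> H m = E (3 * m)%N) ->
  \prod_(1 <= m < (12 * K).+1) G m *
    (\prod_(0 <= i < 6 * K) E (4 * i + 2)%N * \prod_(0 <= i < 3 * K) E (12 * i + 6)%N)
  = \prod_(1 <= m < (12 * K).+1) H m *
    (\prod_(0 <= i < 3 * K) E (4 * i + 2)%N * \prod_(0 <= i < 2 * K) E (12 * i + 6)%N).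
Proof.
move=> GEu GE3' GE2' GE4 HE1' HE2'.
have EE m n : m = n -> E m = E n by move->.
have GE3 m n : odd m -> (3 %| m)%N -> (2 * m = n)%N -> G m = E n.
  by move=> om m3 <-; exact: GE3'.
have GE2 m n : (m %% 4 = 2)%N -> m = n -> G m = E n by move=> m2 <-; exact: GE2'.
have HE1 m n : odd m -> (2 * m = n)%N -> H m = E n by move=> om <-; exact: HE1'.
have HE2 m n : (m %% 4 = 2)%N -> (3 * m = n)%N -> H m = E n.
  by move=> m2 <-; exact: HE2'.
(* Each induction step adds one full period of twelve consecutive indices m. *)
elim: K => [|K IHK]; first by rewrite !muln0 !big_geq.
move: IHK; rewrite !mulnSr !addnS !addn0.
(* Hiding 12K + 1 behind [a] gives the twelve peeled indices the fixed shapes [a], [a.+1], and so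
   on. *)
have [a aE] : exists a, (12 * K).+1 = a by exists (12 * K).+1.
have a_gt0 : (0 < a)%N by rewrite -aE.
rewrite aE => IHK; rewrite !big_nat_recr //=.
rewrite (@GEu a); [|lia..].
rewrite (@HE1 a (24 * K + 2)); [|lia..].
rewrite (@GE2 a.+1 (12 * K + 2)); [|lia..].
rewrite (@HE2 a.+1 (36 * K + 6)); [|lia..].
rewrite (@GE3 a.+2 (24 * K + 6)); [|lia..].
rewrite (@HE1 a.+2 (24 * K + 6)); [|lia..].
rewrite (@GE4 a.+3); [|lia..].
rewrite (@GEu a.+4); [|lia..].
rewrite (@HE1 a.+4 (24 * K + 10)); [|lia..].
rewrite (@GE2 a.+1.+4 (12 * K + 6)); [|lia..].
rewrite (@HE2 a.+1.+4 (36 * K + 18)); [|lia..].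
rewrite (@GEu a.+2.+4); [|lia..].
rewrite (@HE1 a.+2.+4 (24 * K + 14)); [|lia..].
rewrite (@GE4 a.+3.+4); [|lia..].
rewrite (@GE3 a.+4.+4 (24 * K + 18)); [|lia..].
rewrite (@HE1 a.+4.+4 (24 * K + 18)); [|lia..].
rewrite (@GE2 a.+1.+4.+4 (12 * K + 10)); [|lia..].
rewrite (@HE2 a.+1.+4.+4 (36 * K + 30)); [|lia..].
rewrite (@GEu a.+2.+4.+4); [|lia..].
rewrite (@HE1 a.+2.+4.+4 (24 * K + 22)); [|lia..].
rewrite (@GE4 a.+3.+4.+4); [|lia..].
rewrite (@EE (4 * (6 * K) + 2) (24 * K + 2)); [|lia].
rewrite (@EE (4 * (6 * K).+1 + 2) (24 * K + 6)); [|lia].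
rewrite (@EE (4 * (6 * K).+2 + 2) (24 * K + 10)); [|lia].
rewrite (@EE (4 * (6 * K).+3 + 2) (24 * K + 14)); [|lia].
rewrite (@EE (4 * (6 * K).+4 + 2) (24 * K + 18)); [|lia].
rewrite (@EE (4 * (6 * K).+1.+4 + 2) (24 * K + 22)); [|lia].
rewrite (@EE (12 * (3 * K) + 6) (36 * K + 6)); [|lia].
rewrite (@EE (12 * (3 * K).+1 + 6) (36 * K + 18)); [|lia].
rewrite (@EE (12 * (3 * K).+2 + 6) (36 * K + 30)); [|lia].
rewrite (@EE (4 * (3 * K) + 2) (12 * K + 2)); [|lia].
rewrite (@EE (4 * (3 * K).+1 + 2) (12 * K + 6)); [|lia].
rewrite (@EE (4 * (3 * K).+2 + 2) (12 * K + 10)); [|lia].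
rewrite (@EE (12 * (2 * K) + 6) (24 * K + 6)); [|lia].
rewrite (@EE (12 * (2 * K).+1 + 6) (24 * K + 18)); [|lia].
move: IHK; set x1 := \prod_(_ <= _ < _) _; set x2 := \prod_(_ <= _ < _) _.
set x3 := \prod_(_ <= _ < _) _; set x4 := \prod_(_ <= _ < _) _.
set x5 := \prod_(_ <= _ < _) _; set x6 := \prod_(_ <= _ < _) _ => IHK.
ring: IHK.
Qed.

(** * Coefficientwise sign conditions *)

Definition nonneg (f : fps int) := forall n, 0 <= f n.
Definition positive (f : fps int) := forall n, 0 < f n.

Lemma nonnegD f g : nonneg f -> nonneg g -> nonneg (f + g).
Proof. by move=> f0 g0 n; rewrite fpsDE addr_ge0. Qed.

Lemma nonnegM f g : nonneg f -> nonneg g -> nonneg (f * g).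
Proof. by move=> f0 g0 n; rewrite fpsME sumr_ge0 // => i _; rewrite mulr_ge0. Qed.

Lemma nonneg1 : nonneg 1.
Proof. by move=> n; rewrite fps1E ler0n. Qed.

Lemma nonnegXn m : nonneg (q ^+ m).
Proof. by move=> n; rewrite fpsXnE ler0n. Qed.

Lemma nonneg_geo m v : nonneg (geo m v).
Proof.
by move=> n; rewrite fps_sumE sumr_ge0 // => i _; rewrite -exprM; exact: nonnegXn.
Qed.

Lemma oneBXnVE m n : (0 < m)%N -> ((1 - q ^+ m)^-1) n = (m %| n)%:R.
Proof.
move=> m0; rewrite -[RHS]/((FPS (fun n => (m %| n)%:R) : fps int) n).
congr (fps_coef _ n); apply: (mulrI (oneBXn_unit m0)).
rewrite divrr ?oneBXn_unit //; apply: fpsP => {}n.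
rewrite mulrBl mul1r fpsBE fpsXnM fps1E /=.
have [mn|nm] := leqP m n.
  by rewrite dvdn_subl // subrr; case: n mn => //; lia.
by rewrite subr0; case: n nm => [|n] nm; rewrite ?dvdn0 // gtnNdvd.
Qed.

Lemma nonneg_oneBXnV m : (0 < m)%N -> nonneg ((1 - q ^+ m)^-1).
Proof. by move=> m0 n; rewrite oneBXnVE ?ler0n. Qed.

Lemma nonneg_fac m : nonneg (fac m).
Proof.
rewrite /fac; case: ifP => [om|_]; last first.
  by case: ifP => _; [exact: nonneg_geo | exact: nonneg1].
case: ifP => _; first by apply: nonnegD; [exact: nonneg1 | exact: nonnegXn].
exact/nonneg_oneBXnV/odd_gt0.
Qed.

Lemma fac_small m n : (0 < m)%N -> (n < m)%N -> fac m n = (n == 0)%:R.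
Proof.
move=> m0 nm; rewrite /fac.
have Xsmall i : (0 < i)%N -> (q ^+ (m * i)) n = 0.
  by move=> i0; rewrite fpsXnE ltn_eqF // (leq_trans nm) // leq_pmulr.
case: ifP => _; first case: ifP => _.
- by rewrite fpsDE fps1E -[m in q ^+ m]muln1 Xsmall ?addr0.
- rewrite oneBXnVE //; case: n nm {Xsmall} => [|n] nm; rewrite ?dvdn0 //.
  by rewrite gtnNdvd.
case: ifP => _; last by [].
rewrite fps_sumE addn2 big_ord_recl expr0 fps1E big1 ?addr0 // => i _.
by rewrite -exprM Xsmall.
Qed.

(** * The series F and its finite truncations *)

Definition quot : fps int :=
  (qpoch q)^-1 * fps_infprod 1 (fun m => 1 - q ^+ twoN m).

(** [S] records the indices whose factors h_m have already been used in a cancellation. *)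
Definition partial_quot (S : seq nat) M : fps int :=
  \prod_(1 <= m < M | m \notin S) fac m.

Lemma quot_infprod : quot = fps_infprod 1 fac.
Proof.
apply: (mulrI qpoch_q_unit); rewrite /quot mulrA divrr ?qpoch_q_unit // mul1r.
apply: fpsP => n; pose K := n.+1; pose M := (12 * K).+1.
pose E i : fps int := 1 - q ^+ i.
pose A := \prod_(0 <= i < 3 * K) E (4 * i + 2)%N.
pose A' := \prod_(0 <= i < 6 * K) E (4 * i + 2)%N.
pose B := \prod_(0 <= i < 2 * K) E (12 * i + 6)%N.
pose B' := \prod_(0 <= i < 3 * K) E (12 * i + 6)%N.
pose L := \prod_(1 <= m < M) ((1 - q ^+ m) * fac m).
pose T := \prod_(1 <= m < M) (1 - q ^+ twoN m).
have idLT : L * (A' * B') = T * (A * B).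
  apply: (prod_mod12 (E := E)).
  - exact: fac_unit.
  - exact: fac_odd3.
  - exact: fac_mod2.
  - exact: fac_dvd4.
  - by move=> m om; rewrite twoN_odd.
  - by move=> m om; rewrite twoN_mod2.
have Esmall c d i m : (0 < c)%N -> (0 < d)%N -> (m < i)%N ->
    E (c * i + d)%N m = (m == 0)%:R.
  move=> c0 d0 mi; rewrite /E fpsBE fpsXnE ltn_eqF ?subr0 //; nia.
have stab c d N N' : (0 < c)%N -> (0 < d)%N -> (K <= N)%N -> (N <= N')%N ->
    forall m, (m <= n)%N ->
    (\prod_(0 <= i < N') E (c * i + d)%N) m = (\prod_(0 <= i < N) E (c * i + d)%N) m.
  move=> c0 d0 KN NN' m mn.
  apply: (fps_prod_stable (F := fun i => E (c * i + d)%N)) => //.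
    by move=> i j _; exact: Esmall.
  by rewrite (leq_trans _ KN).
have AB_unit : A * B \is a GRing.unit.
  rewrite unitrM; apply/andP; split; rewrite rpred_prod // => i _;
  by rewrite oneBXn_unit // addn_gt0 orbT.
have LT m : (m <= n)%N -> L m = T m.
  (* All four products have at least K = n + 1 factors, and further factors only affect degrees
     above n. Hence [A'] and [B'] agree with [A] and [B] up to degree n, and the correction cancels
     there. *)
  have -> : T = L * (A' * B') / (A * B) by rewrite idLT mulrK.
  move=> mn; rewrite -[LHS](congr1 (fun f : fps int => f m) (mulrK AB_unit L)).
  symmetry; apply: (fpsM_eq_upto (m := n)) => // {}m {}mn.
  apply: (fpsM_eq_upto (m := n)) => // {}m {}mn.
  apply: (fpsM_eq_upto (m := n)) => // {}m {}mn; apply: stab => //; lia.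
have nM : (n < M)%N by rewrite /M /K; lia.
rewrite (@fps_infprodE _ 1 _ _ n M) //; last first.
  move=> i m _ mi; rewrite fpsBE fpsXnE ltn_eqF ?subr0 //.
  by rewrite (leq_trans mi) // leq_pmulr // addn2.
rewrite -/T -LT //; symmetry.
have -> : L = \prod_(1 <= m < M) (1 - q ^+ m) * \prod_(1 <= m < M) fac m.
  exact: big_split.
apply: (fpsM_eq_upto (m := n)) => // m mn.
  rewrite (@qpoch_upto _ (12 * K)); last by rewrite /K; lia.
  by rewrite big_add1.
by rewrite (@fps_infprodE _ 1 _ _ m M) //; [exact: fac_small | lia].
Qed.

Lemma quotM_upto X n M : (n < M)%N -> (X * quot) n = (X * partial_quot [::] M) n.
Proof.
move=> nM; apply: (fpsM_eq_upto (m := n)) => // m mn.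
rewrite quot_infprod (@fps_infprodE _ 1 _ _ m M) //; first exact: fac_small.
exact: leq_ltn_trans nM.
Qed.

Lemma partial_quot_cons x S M : (0 < x)%N -> (x < M)%N -> x \notin S ->
  partial_quot S M = fac x * partial_quot (x :: S) M.
Proof.
move=> x0 xM xS; rewrite /partial_quot big_mkcond.
rewrite (bigD1_seq x) ?iota_uniq //=; last first.
  by rewrite mem_index_iota x0.
rewrite xS; congr (_ * _); rewrite big_mkcond [RHS]big_mkcond.
by apply: eq_bigr => i _; rewrite inE negb_or; case: eqP.
Qed.

Lemma nonneg_partial_quot S M : nonneg (partial_quot S M).
Proof.
apply: (big_ind nonneg).
- exact: nonneg1.
- exact: nonnegM.
- by move=> m _; exact: nonneg_fac.
Qed.

Lemma partial_quot0 S M : partial_quot S M 0%N = 1.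
Proof.
rewrite /partial_quot big_nat_cond; elim/big_ind: _ => //.
  by move=> f g f0 g0; rewrite fpsM0 f0 g0.
by move=> m /andP[/andP[m0 _] _]; rewrite fac_small.
Qed.

(** * Positivity of the triple products times F *)

Lemma positiveDnonneg f g : positive f -> nonneg g -> positive (f + g).
Proof. by move=> f0 g0 n; rewrite fpsDE ltr_wpDr. Qed.

Lemma positiveM f g : positive f -> nonneg g -> 0 < g 0%N -> positive (f * g).
Proof.
move=> f0 g0 g00 n; rewrite fpsME big_ord_recr /= subnn ltr_wpDl ?mulr_gt0 //.
by rewrite sumr_ge0 // => i _; rewrite mulr_ge0 // ltW.
Qed.

Lemma geo1D u v : geo 1 (u + v) = geo 1 u + q ^+ u * geo 1 v.
Proof.
rewrite /geo big_split_ord; congr (_ + _); rewrite mulr_sumr; apply: eq_bigr => i _.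
by rewrite -!exprM !mul1n exprD.
Qed.

Lemma oneBXn_geo v : 1 - q ^+ v = geo 1 v * (1 - q ^+ 1).
Proof. by rewrite mulrC geoE mul1n. Qed.

Lemma partial_quot_unit p S M :
  odd p -> ~~ (3 %| p)%N -> (p < M)%N -> p \notin S ->
  (1 - q ^+ p) * partial_quot S M = partial_quot (p :: S) M.
Proof.
move=> op p3 pM pS.
by rewrite (partial_quot_cons (odd_gt0 op)) // mulrA fac_unit // mul1r.
Qed.

(** Up to nonnegative terms, [geo 1 v] may be shortened to [geo 1 4], which h_4 turns into
    [geo 1 16] because 2N_4 = 16. This may be shortened to [geo 1 p], which h_p turns into 1 / (1 -
    q), a series with all coefficients 1. *)
Lemma positive_geo_quot p v S M :
  (4 <= v)%N -> (4 < M)%N -> 4%N \notin S ->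
  odd p -> ~~ (3 %| p)%N -> (p <= 16)%N -> (p < M)%N -> p \notin S ->
  positive (geo 1 v * partial_quot S M).
Proof.
move=> v4 M4 S4 op p3 p16 pM pS.
have p4 : p \notin 4%N :: S by rewrite inE negb_or pS andbT; lia.
rewrite -(subnKC v4) geo1D mulrDl; apply: positiveDnonneg; last first.
  by apply: nonnegM; [apply: nonnegM; [exact: nonnegXn | exact: nonneg_geo]
                     | exact: nonneg_partial_quot].
rewrite (@partial_quot_cons 4) // mulrA.
have -> : geo 1 4 * fac 4 = geo 1 16.
  apply: (mulrI (oneBXn_unit (ltn0Sn 0))).
  by rewrite mulrA (geoE 1 4) (geoE 1 16) mul1n fac_dvd4.
rewrite -(subnKC p16) geo1D mulrDl; apply: positiveDnonneg; last first.
  by apply: nonnegM; [apply: nonnegM; [exact: nonnegXn | exact: nonneg_geo]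
                     | exact: nonneg_partial_quot].
rewrite (partial_quot_cons (odd_gt0 op) pM p4) mulrA; apply: positiveM.
- have -> : geo 1 p * fac p = (1 - q ^+ 1)^-1.
    apply: (mulrI (oneBXn_unit (ltn0Sn 0))).
    by rewrite mulrA geoE mul1n fac_unit // divrr // oneBXn_unit.
  by move=> n; rewrite oneBXnVE // dvd1n.
- exact: nonneg_partial_quot.
- by rewrite partial_quot0.
Qed.

(** The factor 1 - q taken out of 1 - q^v cancels h_1, the other two cancel h_u and h_w, and h_5 is
    left for [positive_geo_quot]. *)
Lemma positive_coprime3 u w v M : odd u -> ~~ (3 %| u)%N -> odd w -> ~~ (3 %| w)%N ->
  uniq [:: 1%N; 5; u; w] -> (4 <= v)%N -> (u < M)%N -> (w < M)%N -> (5 < M)%N ->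
  positive ((1 - q ^+ u) * (1 - q ^+ w) * (1 - q ^+ v) * partial_quot [::] M).
Proof.
move=> ou u3 ow w3; rewrite /= !inE => uw v4 uM wM M5.
have -> : (1 - q ^+ u) * (1 - q ^+ w) * (1 - q ^+ v) * partial_quot [::] M =
    geo 1 v * ((1 - q ^+ 1) * ((1 - q ^+ u) * ((1 - q ^+ w) * partial_quot [::] M))).
  by rewrite (oneBXn_geo v); ring.
rewrite !partial_quot_unit ?inE //; try lia.
by apply: (positive_geo_quot (p := 5)) => //; rewrite ?inE; lia.
Qed.

Lemma partial_quot_split y z S M :
  odd y -> ~~ (3 %| y)%N -> (y < M)%N -> y \notin S ->
  odd z -> ~~ (3 %| z)%N -> (z < M)%N -> z \notin S ->
  (1 - q ^+ (y + z)) * partial_quot S M =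
  partial_quot (y :: S) M + q ^+ y * partial_quot (z :: S) M.
Proof.
move=> oy y3 yM yS oz z3 zM zS.
by rewrite -(partial_quot_unit oy) // -(partial_quot_unit oz) // exprD; ring.
Qed.

Lemma partial_quot_odd3 x S M : odd x -> (3 %| x)%N -> (x.+2 < M)%N ->
  x \notin S -> (x - 2)%N \notin S -> x.+2 \notin S ->
  (1 - q ^+ x) * partial_quot S M =
  partial_quot [:: (x - 2)%N, x & S] M
    + q ^+ (x - 2) * partial_quot [:: x.+2, x & S] M.
Proof.
move=> ox x3 xM xS xS1 xS2.
rewrite (partial_quot_cons (odd_gt0 ox) _ xS) ?mulrA ?fac_odd3 //; last lia.
have -> : (2 * x = (x - 2) + x.+2)%N by lia.
by rewrite partial_quot_split ?inE ?negb_or ?xS1 ?xS2 ?andbT //; lia.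
Qed.

(** Splitting 1 - q^{2x} gives two summands. Strict positivity is taken from the one that uses
    h_{x-2}, so [p] has to avoid x - 2, 1 and u; the other is only shown nonnegative. *)
Lemma positive_odd3 p x u v M : odd x -> (3 %| x)%N -> (9 <= x)%N ->
  odd u -> ~~ (3 %| u)%N -> uniq [:: 1%N; u; (x - 2)%N; x.+2] -> (4 <= v)%N ->
  odd p -> ~~ (3 %| p)%N -> (p <= 16)%N -> p \notin [:: (x - 2)%N; 1%N; u] ->
  (u < M)%N -> (x.+2 < M)%N -> (16 < M)%N ->
  positive ((1 - q ^+ x) * (1 - q ^+ u) * (1 - q ^+ v) * partial_quot [::] M).
Proof.
move=> ox x3 x9 ou u3; rewrite /= !inE => ux v4 op p3 p16 pS uM xM M16.
have -> : (1 - q ^+ x) * (1 - q ^+ u) * (1 - q ^+ v) * partial_quot [::] M =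
    geo 1 v * ((1 - q ^+ x) * ((1 - q ^+ 1) * ((1 - q ^+ u) * partial_quot [::] M))).
  by rewrite (oneBXn_geo v); ring.
rewrite (@partial_quot_unit u) ?(@partial_quot_unit 1) ?inE //; try lia.
rewrite partial_quot_odd3 // ?inE; try lia.
rewrite mulrDr; apply: positiveDnonneg.
  by apply: (positive_geo_quot (p := p)) => //; rewrite ?inE; lia.
apply: nonnegM; first exact: nonneg_geo.
by apply: nonnegM; [exact: nonnegXn | exact: nonneg_partial_quot].
Qed.

(* Here 1 - q^6 = (1 - q) + ... + q^5 (1 - q) uses up the factor 1 - q, so that
   1 - q^8 is treated through (1 - q^8) h_8 = 1 - q^40 and 40 = 11 + 29. *)
Lemma positive_358 M : (40 < M)%N ->
  positive ((1 - q ^+ 3) * (1 - q ^+ 5) * (1 - q ^+ 8) * partial_quot [::] M).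
Proof.
move=> M40; have le_M i : (i <= 40)%N -> (i < M)%N by move/leq_ltn_trans; apply.
rewrite (@partial_quot_cons 3 _ _ isT (le_M 3%N isT)) //.
rewrite (@partial_quot_cons 8 _ _ isT (le_M 8%N isT)) //.
rewrite (@partial_quot_cons 5 _ _ isT (le_M 5%N isT)) //.
have -> X : (1 - q ^+ 3) * (1 - q ^+ 5) * (1 - q ^+ 8) * (fac 3 * (fac 8 * (fac 5 * X))) =
    ((1 - q ^+ 3) * fac 3) * ((1 - q ^+ 5) * fac 5) * ((1 - q ^+ 8) * fac 8) * X.
  ring.
rewrite fac_odd3 // fac_unit // fac_dvd4 // (_ : twoN 8 = 40%N) //.
set S := [:: _; _; _].
have -> : (1 - q ^+ (2 * 3)) * 1 * (1 - q ^+ 40) * partial_quot S M =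
    geo 1 6 * ((1 - q ^+ (11 + 29)) * ((1 - q ^+ 1) * partial_quot S M)).
  by rewrite (oneBXn_geo (2 * 3)); ring.
rewrite (@partial_quot_unit 1 _ _ isT isT (le_M 1%N isT)) //.
rewrite (@partial_quot_split 11 29) ?le_M // mulrDr; apply: positiveDnonneg.
  exact: (@positive_geo_quot 7 _ _ _ _ (le_M 4%N isT) _ _ _ _ (le_M 7%N isT)).
apply: nonnegM; first exact: nonneg_geo.
by apply: nonnegM; [exact: nonnegXn | exact: nonneg_partial_quot].
Qed.

Definition triple k : fps int :=
  (1 - q ^+ (k + 2)) * (1 - q ^+ (2 * k + 3)) * (1 - q ^+ (3 * k + 5)).

(** The even exponent is a for even k and c for odd k. Since c = 2 mod 3, and 3 divides a only if k
    = 1 mod 3 and b only if 3 | k, at most one of the odd exponents is a multiple of 3. The case k =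
    1 is apart because there a = 3 and x - 2 = 1 is already used. *)
Lemma positive_triple k : (0 < k)%N -> positive (triple k * quot).
Proof.
move=> k0 n; pose M := (n + 10 * k + 50)%N.
rewrite (@quotM_upto _ _ M); last by rewrite /M; lia.
suff: positive (triple k * partial_quot [::] M) by apply.
have kM : (3 * k + 50 < M)%N by rewrite /M; lia.
clearbody M; rewrite /triple.
have [->|k1] := eqVneq k 1%N; first by apply: positive_358; lia.
have [ok|ek] := boolP (odd k); last first.
  rewrite -mulrA [X in X * partial_quot _ _]mulrC.
  have [b3|b3] := boolP (3 %| 2 * k + 3)%N.
    by apply: (@positive_odd3 5); rewrite /= ?inE; lia.
  by apply: positive_coprime3; rewrite /= ?inE; lia.
have [a3|a3] := boolP (3 %| k + 2)%N.
  by apply: (@positive_odd3 5); rewrite /= ?inE; lia.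
have [b3|b3] := boolP (3 %| 2 * k + 3)%N; last first.
  by apply: positive_coprime3; rewrite /= ?inE; lia.
rewrite [(1 - _) * (1 - _)]mulrC.
(* For k = 3 the exponent a = 5 uses up h_5, so p = 13 replaces p = 5. *)
have [->|k3] := eqVneq k 3; first by apply: (@positive_odd3 13); rewrite /= ?inE; lia.
by apply: (@positive_odd3 5); rewrite /= ?inE; lia.
Qed.

(** If 3 | b then b >= 9, so the indices b - 2 and b + 2 of the splitting differ from 1, whose
    factor is spent on 1 - q. *)
Lemma nonneg_pair b : odd b -> (5 <= b)%N ->
  nonneg ((1 - q ^+ 1) * (1 - q ^+ b) * quot).
Proof.
move=> ob b5 n; pose M := (n + b + 3)%N.
rewrite (@quotM_upto _ _ M); last by rewrite /M; lia.
suff: nonneg ((1 - q ^+ 1) * (1 - q ^+ b) * partial_quot [::] M) by apply.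
have kM : (b.+2 < M)%N by rewrite /M; lia.
clearbody M; rewrite mulrAC mulrC (@partial_quot_unit 1) //; last by lia.
have [b3|b3] := boolP (3 %| b)%N; last first.
  rewrite partial_quot_unit ?inE //; try lia; exact: nonneg_partial_quot.
rewrite partial_quot_odd3 ?inE //; try lia.
apply: nonnegD; first exact: nonneg_partial_quot.
by apply: nonnegM; [exact: nonnegXn | exact: nonneg_partial_quot].
Qed.

Lemma nonneg_quot1 : nonneg ((1 - q ^+ 1) * quot).
Proof.
move=> n; rewrite (@quotM_upto _ _ n.+2) // partial_quot_unit //.
exact: nonneg_partial_quot.
Qed.

Lemma positive_quot : positive quot.
Proof.
have -> : quot = (1 - q ^+ 1)^-1 * ((1 - q ^+ 1) * quot).
  by rewrite mulrA mulVr ?mul1r // oneBXn_unit.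
apply: positiveM => [n||]; first by rewrite oneBXnVE // dvd1n.
  exact: nonneg_quot1.
by rewrite fpsM0 fpsBE quot_infprod (@fps_infprodE _ 1 _ fac_small 0 1) // big_geq.
Qed.

(** * The recursion for E_k and the signs of the coefficients of C_k *)

Lemma CkE k : Ck k = pentagonal_tail k * quot.
Proof.
rewrite /Ck /pentagonal_tail /quot -(mulVr qpoch_q_unit).
set P := qpoch q; ring.
Qed.

(** This is E_k F. *)
Definition excess k : fps int := (pentagonal_tail k - q ^+ gk k * (1 - q ^+ k.-1)) * quot.

Lemma excessE k : (0 < k)%N ->
  excess k = q ^+ (gk k + k.-1) * (triple k * quot)
    + q ^+ (gk k + k.-1 + (4 * k + 6)) * ((1 - q ^+ 1) * (1 - q ^+ (2 * k + 3)) * quot)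
    + excess k.+2.
Proof.
case: k => // k _; rewrite /excess /triple.
rewrite (pentagonal_tailS k.+1) (pentagonal_tailS k.+2) !gkS /= !mulnS !exprD !exprS.
by rewrite ?expr0; ring.
Qed.

Lemma fpsM_small (f g : fps int) m n :
  (forall i, (i < m)%N -> f i = 0) -> (n < m)%N -> (f * g) n = 0.
Proof.
by move=> f0 nm; rewrite fpsME big1 // => i _; rewrite f0 ?mul0r // (leq_trans _ nm).
Qed.

(** The recursion [excessE] raises k by two; once k > n, also g_k > n and the coefficient at n
    vanishes. *)
Lemma nonneg_excess k : (0 < k)%N -> nonneg (excess k).
Proof.
move=> k0 n; elim: {k}(n.+1 - k)%N {-2}k (leqnn (n.+1 - k)) k0 => [|d IHd] k dk k0.
  rewrite /excess (@fpsM_small _ _ (gk k)) //; last by have := leq_gk k; lia.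
  by move=> i ik; rewrite fpsBE pentagonal_tail_vanish // fpsXnM leqNgt ik subr0.
rewrite excessE // !fpsDE addr_ge0 ?IHd //; try lia.
apply: addr_ge0.
  by apply: nonnegM; [exact: nonnegXn | move=> i; exact/ltW/positive_triple].
apply: nonnegM; first exact: nonnegXn.
apply: nonneg_pair; lia.
Qed.

Lemma Ck_small k n : (n < gk k)%N -> Ck k n = 0.
Proof. by rewrite CkE; apply: fpsM_small; exact: pentagonal_tail_vanish. Qed.

Lemma Ck_gt0 k n : (0 < k)%N -> (gk k <= n)%N -> 0 < Ck k n.
Proof.
move=> k0 kn.
have -> : Ck k = q ^+ gk k * ((1 - q ^+ k.-1) * quot + q ^+ k.-1 * (triple k * quot))
    + (q ^+ (gk k + k.-1 + (4 * k + 6)) * ((1 - q ^+ 1) * (1 - q ^+ (2 * k + 3)) * quot)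
    + excess k.+2).
  have := excessE k0; rewrite CkE {1}/excess mulrBl => /eqP; rewrite subr_eq => /eqP ->.
  rewrite exprD; ring.
rewrite fpsDE ltr_wpDr //.
  rewrite fpsDE addr_ge0 ?nonneg_excess //.
  by apply: nonnegM; [exact: nonnegXn | apply: nonneg_pair; lia].
rewrite fpsXnM kn fpsDE [X in _ + X]fpsXnM.
(* From degree g_k + k - 1 on, strictness comes from the triple product; below it, q^{k-1} does not
   contribute and the coefficient is one of F itself. *)
case: ifPn => kn'.
  rewrite ltr_wpDl ?positive_triple // oneBXn_geo -mulrA.
  by apply: nonnegM; [exact: nonneg_geo | exact: nonneg_quot1].
rewrite addr0 mulrBl mul1r fpsBE fpsXnM ifN // subr0; exact: positive_quot.
Qed.

Theorem theorem1 (k : nat) :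
  (0 < k)%N ->
  (forall n : nat, 0 <= Ck k n) /\
  (forall n : nat, 0 < Ck k n <-> (gk k <= n)%N).
Proof.
move=> k0; split=> n; last first.
  by split=> [|/(Ck_gt0 k0) //]; rewrite leqNgt; apply: contraL => /Ck_small ->.
by have [/Ck_small -> //|/(Ck_gt0 k0)/ltW] := ltnP n (gk k).
Qed.
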